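(* Let $N\ge1$ and $k\ge1$ be integers and let $M_N$ be the multicomplex of the integers $\{1,2,\dots,N\}$. The spectrum $\boldsymbol{s}'_{k-1}(N)$ of the operator $L'_{k-1}$ of $M_N$ is given (up to the multiplicity of $0$) by $$\boldsymbol{s}'_{k-1}(N)^T=\sum_{\substack{1\le \ell\le N\\ \Omega(\ell)=k}}\underline{\log(\ell)}=\sum_{\substack{1\le \ell\le N\\ \Omega(\ell)=k}}\log(\operatorname{sfp}(\ell)),$$ where $^T$ denotes the conjugate partition and the sums are componentwise. Hence, if $t_k^i(N)$ and $s_k^j(N)$ are defined by $$\boldsymbol{s}'_{k-1}(N)^T=(t_k^1(N),t_k^2(N),\dots),\qquad \boldsymbol{s}'_{k-1}(N)=(s_k^1(N),s_k^2(N),\dots),$$ then $$t_k^i(N)=\#\{\,1<n\le N:\ \Omega(n)=k,\ p_i\mid \operatorname{sfp}(n)\,\},$$ $$s_k^j(N)=\#\{\,i:\ t_k^i(N)\ge j\,\}=\#\bigl\{\,\ell:\ \#\{1<n\le N:\ \Omega(n)=k,\ p_\ell\mid\operatorname{sfp}(n)\}\ge j\,\bigr\}.$$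
   Context: Let $p_i$ denote the $i$-th prime. For a positive integer $m=p_1^{a_1}\cdots p_r^{a_r}$ put $\log(m)=(a_1,a_2,\dots)$ (finitely supported exponent sequence), let $\Omega(m)=\sum_i a_i$ be the number of prime factors counted with multiplicity, let $\underline{b}=1$ if $b$ is odd and $0$ if $b$ is even, applied componentwise to sequences, and let $\operatorname{sfp}(m)=\prod_i p_i^{\underline{a_i}}$ (the ''squarefree part''). A multicomplex on an ordered set $x_1<\dots<x_n$ of variables is a finite set $M$ of monomials in $x_1,\dots,x_n$ closed under taking divisors; $M_d$ is the set of its monomials of total degree $d$. $M_N$ is the multicomplex obtained by identifying each $m=p_1^{a_1}\cdots p_r^{a_r}\in\{1,\dots,N\}$ with the monomial $x_1^{a_1}\cdots x_r^{a_r}$ (the variables corresponding to the primes $\le N$). For a multicomplex $M$, the boundary operator $\partial_d:\mathbb{R}M_d\to\mathbb{R}M_{d-1}$ is the linear map $$\partial_d(x_1^{a_1}\cdots x_n^{a_n})=\sum_{j=1}^n(-1)^{a_1+\dots+a_{j-1}}\,r_j\,x_1^{a_1}\cdots x_j^{a_j-1}\cdots x_n^{a_n},$$ with $r_j=1$ if $a_j$ is odd and $r_j=0$ if $a_j$ is even; $\partial_d^*$ is its transpose with respect to the monomial bases, and $L'_d=\partial_{d+1}\partial_{d+1}^*$ on $\mathbb{R}M_d$. The spectrum $\boldsymbol{s}'_d$ is the multiset of eigenvalues of $L'_d$, written as a weakly decreasing sequence; $\boldsymbol{s}'_d(N)$ denotes this for $M=M_N$. Partitions that differ only in the number of zero parts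 are identified (sequences are padded by zeros). *)

(* Defs.v *)
(* Indices are 0-based throughout: [nth_prime i], the variable of index
   [i : 'I_n] and the entry of index [i] of a sequence are the customary
   p_{i+1}, x_{i+1} and (i+1)-st entry. *)
From HB Require Import structures.
From mathcomp Require Import all_boot all_order all_algebra finmap mpoly.
From mathcomp Require Import classical_sets cardinality reals.

Set Implicit Arguments.
Unset Strict Implicit.
Unset Printing Implicit Defensive.

Import Order.TTheory GRing.Theory Num.Theory.

Lemma ex_prime_above (m : nat) : exists p, (m < p) && prime p.
Proof. by have [p lt_mp pr_p] := prime_above m; exists p; rewrite lt_mp. Qed.

Definition next_prime (m : nat) : nat := ex_minn (ex_prime_above m).

Definition nth_prime (i : nat) : nat := iter i.+1 next_prime 0.

Definition prime_count (N : nat) : nat := count prime (iota 1 N).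

Definition logseq (m i : nat) : nat := logn (nth_prime i) m.

Definition Omega (m : nat) : nat := \sum_(p <- primes m) logn p m.

Definition parity (b : nat) : nat := odd b.

Definition sfp (m : nat) : nat := \prod_(p <- primes m) p ^ parity (logn p m).

Record multicomplex (n : nat) := Multicomplex {
  monomials :> {fset 'X_{1..n}};
  monomials_closed : forall m m' : 'X_{1..n},
    m \in monomials -> (m' <= m)%MM -> m' \in monomials
}.

Section Boundary.
Local Open Scope ring_scope.
Local Open Scope fset_scope.
Variables (R : realType) (n : nat) (M : multicomplex n).

Definition graded (d : nat) : {fset 'X_{1..n}} :=
  [fset m in monomials M | mdeg m == d].

(* The coefficient of the monomial [b] in the boundary of the monomial [a].
   When [a j = 0] the truncated difference [a - U_(j)] is [a], but the term
   vanishes since [a j] is even. *)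
Definition boundary_coef (a b : 'X_{1..n}) : R :=
  \sum_(j < n | (a - U_(j))%MM == b)
     (-1) ^+ (\sum_(i < n | (i < j)%N) a i)%N * (parity (a j))%:R.

(* The matrix, acting on column vectors, of the boundary operator
   from degree [d.+1] to degree [d] in the monomial bases. *)
Definition boundary (d : nat) :
    'M[R]_(#|{: graded d}|, #|{: graded d.+1}|) :=
  \matrix_(i, j) boundary_coef (val (enum_val j)) (val (enum_val i)).

Definition laplacian_up (d : nat) : 'M[R]_#|{: graded d}| :=
  boundary d *m (boundary d)^T.

End Boundary.

Section Spectrum.
Local Open Scope ring_scope.

(* [s] lists the eigenvalues of [A], with multiplicity, in weakly decreasing
   order; there is at most one such [s] (lemma [is_spectrum_unique]). *)
Definition is_spectrum (R : realType) (n : nat) (A : 'M[R]_n) (s : seq R) :=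
  sorted >=%R s /\ char_poly A = \prod_(x <- s) ('X - x%:P).

Lemma is_spectrum_unique (R : realType) (n : nat) (A : 'M[R]_n) (s t : seq R) :
  is_spectrum A s -> is_spectrum A t -> s = t.
Proof.
case=> s_sorted As [t_sorted At]; apply: (@sorted_eq _ >=%R) => //.
- by move=> x y z; exact: ge_trans.
- by move=> x y; rewrite andbC; exact: le_anti.
- by apply: prod_XsubC_eq; rewrite -As.
Qed.

End Spectrum.

(* The conjugate of the partition [s] (possibly with zero parts), as a
   finitely supported sequence. *)
Definition conjugate (s : seq nat) (i : nat) : nat := count (fun x => i < x) s.

Lemma next_primeP (m : nat) : m < next_prime m /\ prime (next_prime m).
Proof. by rewrite /next_prime; case: ex_minnP => p /andP[]. Qed.

Lemma prime_nth_prime (i : nat) : prime (nth_prime i).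
Proof.
by rewrite /nth_prime iterS; have [] := next_primeP (iter i next_prime 0).
Qed.

Lemma nth_prime_inj : injective nth_prime.
Proof.
have H i j : i < j -> nth_prime i < nth_prime j.
  apply: (homo_ltn (r := fun x y : nat => x < y)); first exact: ltn_trans.
  by move=> k; have [] := next_primeP (nth_prime k).
by move=> i j eq_ij; case: (ltngtP i j) => // /H; rewrite eq_ij ltnn.
Qed.

Lemma logn_prod_gt0 (I : finType) (F : I -> nat) (p : nat) :
  (forall i, 0 < F i) -> logn p (\prod_i F i) = \sum_i logn p (F i).
Proof.
move=> F_gt0; suff: 0 < \prod_i F i /\ logn p (\prod_i F i) = \sum_i logn p (F i).
  by case.
apply: (big_rec2 (fun x y => 0 < x /\ logn p x = y)); first by rewrite logn1.
by move=> i y x _ [x_gt0 <-]; rewrite muln_gt0 F_gt0 x_gt0 lognM.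
Qed.

Lemma logn_prime_powers (n : nat) (a : 'I_n -> nat) (j : 'I_n) :
  logn (nth_prime j) (\prod_(i < n) nth_prime i ^ a i) = a j.
Proof.
rewrite logn_prod_gt0 => [|i]; last by rewrite expn_gt0 prime_gt0 ?prime_nth_prime.
rewrite (bigD1 j) //= big1 => [|i ne_ij].
  by rewrite pfactorK ?prime_nth_prime ?addn0.
rewrite lognX logn_prime ?prime_nth_prime // (inj_eq nth_prime_inj) eq_sym.
by rewrite (inj_eq val_inj) (negbTE ne_ij) muln0.
Qed.

Section IntegerMulticomplex.
Local Open Scope fset_scope.
Variable N : nat.

Definition integer_monomial (m : nat) : 'X_{1..prime_count N} :=
  [multinom logseq m i | i < prime_count N].

Definition integer_monomials : {fset 'X_{1..prime_count N}} :=
  [fset integer_monomial m | m in iota 1 N].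

Lemma integer_monomials_closed (m m' : 'X_{1..prime_count N}) :
  m \in integer_monomials -> (m' <= m)%MM -> m' \in integer_monomials.
Proof.
case/imfsetP => q /=; rewrite mem_iota add1n ltnS => /andP[q_gt0 le_qN] ->.
move=> /mnm_lepP le_m'.
pose u := \prod_(i < prime_count N) nth_prime i ^ m' i.
have u_gt0 : 0 < u.
  by apply: prodn_gt0 => i; rewrite expn_gt0 prime_gt0 ?prime_nth_prime.
have u_dvd : u %| q.
  apply/dvdn_partP => // p; rewrite mem_primes => /and3P[pr_p _ p_dvd].
  have [i p_eq] : exists i : 'I_(prime_count N), p = nth_prime i.
    have: p %| u by [].
    rewrite /u; elim/big_rec: _ => [|i x _ IH]; first by rewrite Euclid_dvd1.
    rewrite Euclid_dvdM // => /orP[|/IH //].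
    rewrite Euclid_dvdX // dvdn_prime2 ?prime_nth_prime // => /andP[/eqP -> _].
    by exists i.
  rewrite p_part pfactor_dvdn // p_eq logn_prime_powers.
  by have := le_m' i; rewrite mnmE.
apply/imfsetP; exists u => /=.
  by rewrite mem_iota add1n ltnS u_gt0 (leq_trans (dvdn_leq _ u_dvd)).
by apply/mnmP => j; rewrite mnmE /logseq logn_prime_powers.
Qed.

Definition integer_multicomplex : multicomplex (prime_count N) :=
  Multicomplex integer_monomials_closed.

End IntegerMulticomplex.

(* Main.v *)
Require Import Defs.
From HB Require Import structures.
From mathcomp Require Import all_boot all_order all_algebra finmap mpoly.
From mathcomp Require Import classical_sets cardinality reals.
From mathcomp Require Import ring zify fintype finset.

Set Implicit Arguments.
Unset Strict Implicit.
Unset Printing Implicit Defensive.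

Import Order.TTheory GRing.Theory Num.Theory.

(** Write a monomial as a square times a squarefree monomial, that is, as a pair
    (square part, set of the variables of odd exponent). The boundary operator
    leaves the square part alone and acts on the set as the boundary operator of
    the exterior algebra. Replacing a prime by a smaller one makes an integer
    smaller, so in a degree of [M_N] the family of these pairs is shifted: a
    variable of odd exponent can be traded for an earlier variable of even
    exponent ([odd_shifted_integers]). The corollary is therefore an instance of
    the Duval-Reiner theorem, that the spectrum of a shifted family is conjugate
    to its degree sequence, where the degree of a variable is the number of
    members in which its exponent is odd.

    To avoid eigenvectors and sorted sequences, the theorem is proved in the
    multiplicative form of [det_shifted_laplacian]: for real x < 0,
      det (x - L) = x^m prod_(y in F) prod_(j in y) (x - j - 1) / (x - j),
    with m the size of L and indices j counted from 0. It says the same thing,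
    because (x - s) / x telescopes as prod_(j < s) (x - j - 1) / (x - j), so that
    a partition contributes the factor of index j as often as its conjugate has
    at j ([prod_conjugate]). In this form the contributions of different square
    parts just multiply, and negative x avoids all the zero denominators.

    The formula follows by induction on the first variable acted on. Let b remove
    this variable and let D be the boundary in the later variables. Let E project
    on the members of the family that do not contain the variable (deletion), and
    P on the sets obtained by removing it from the members that do (link). Since
    the family is shifted, D maps the deletion into the link, and with
    U = 1 - b^T D the Laplacian is U (D E D^T + P) U^T. Moving U^T in front
    of U inside the determinant turns this into P + A + C, where A = D E D^T, and
    C = P D^T D P has the same characteristic polynomial as D P D^T, and A C = 0.
    So the spectrum of L is, up to zeros, that of A and C together, increased by 1
    on the link ([near_cone_det]); A and C are handled by the induction
    hypothesis for the deletion and for the link. *)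

(** * Determinants of products *)

Section Determinants.
Local Open Scope ring_scope.
Variable R : fieldType.

(** Sylvester's identity, from the two ways of eliminating a block in
    [block_mx 1 A B 1]. *)
Lemma det_1sub_mulC m n (A : 'M[R]_(m, n)) (B : 'M[R]_(n, m)) :
  \det (1%:M - A *m B) = \det (1%:M - B *m A).
Proof.
have eA : block_mx 1%:M A B 1%:M
    = block_mx 1%:M A 0 1%:M *m block_mx (1%:M - A *m B) 0 B 1%:M.
  by rewrite mulmx_block !mul1mx !mul0mx !mulmx1 !add0r subrK.
have eB : block_mx 1%:M A B 1%:M
    = block_mx 1%:M 0 B 1%:M *m block_mx 1%:M A 0 (1%:M - B *m A).
  by rewrite mulmx_block !mul1mx !mul0mx !mulmx1 !addr0 [B *m A + _]addrC subrK.
have := congr1 determinant eA; rewrite {1}eB !det_mulmx !det_lblock !det_ublock.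
by rewrite !det1 !mulr1 !mul1r.
Qed.

Lemma det_scalar_sub_mulC m n (x : R) (A : 'M[R]_(m, n)) (B : 'M[R]_(n, m)) :
  x != 0 ->
  x ^+ n * \det (x%:M - A *m B) = x ^+ m * \det (x%:M - B *m A).
Proof.
move=> x0.
have scale p q (C : 'M[R]_(p, q)) (D : 'M[R]_(q, p)) :
    \det (x%:M - C *m D) = x ^+ p * \det (1%:M - (x^-1 *: C) *m D).
  rewrite -detZ scalerBr -scalemxAl scalerA mulfV // scale1r.
  by rewrite scalemx1.
rewrite !scale mulrCA; congr (_ * (_ * _)).
by rewrite det_1sub_mulC -scalemxAr -scalemxAl.
Qed.

Lemma det_scalar_sub_sqmulC m (x : R) (A B : 'M[R]_m) :
  x != 0 -> \det (x%:M - A *m B) = \det (x%:M - B *m A).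
Proof.
move=> x0; apply: (mulfI (expf_neq0 m x0)); exact: det_scalar_sub_mulC.
Qed.

(** Matrices with A B = 0 have additive nonzero spectra (the spectrum of A + B is the
    union of theirs), because (x - A) (x - B) = x (x - (A + B)). *)
Lemma det_scalar_sub_add m (x : R) (A B : 'M[R]_m) : A *m B = 0 ->
  x ^+ m * \det (x%:M - (A + B)) = \det (x%:M - A) * \det (x%:M - B).
Proof.
move=> AB; rewrite -det_mulmx -detZ; congr (\det _).
rewrite mulmxBl !mulmxBr AB subr0 !mul_scalar_mx mul_mx_scalar.
by rewrite scalerBr scalerDr opprD addrA addrAC.
Qed.
End Determinants.

(** * Weighted substitution matrices *)

(** The matrix of the operator that maps the basis vector [y] to [c y] times the
    basis vector [f y]. All operators used below are sums of such matrices, so that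
    identities between them reduce to identities between the coefficients. *)
HB.lock Definition pmx (R : realFieldType) (T : finType) (f : T -> T)
    (c : T -> R) : 'M[R]_#|T| :=
  \matrix_(i, j) (c (enum_val j) *+ (enum_val i == f (enum_val j)))%R.

Section PartialPermutations.
Local Open Scope ring_scope.
Variables (R : realFieldType) (T : finType).
Implicit Types (f g : T -> T) (c e : T -> R) (F : {set T}).

Lemma pmxE f c i j :
  pmx f c i j = c (enum_val j) *+ (enum_val i == f (enum_val j)).
Proof. by rewrite pmx.unlock mxE. Qed.

Lemma eq_pmx f g c e : f =1 g -> c =1 e -> pmx f c = pmx g e.
Proof. by move=> fg ce; apply/matrixP=> i j; rewrite !(mxE, pmxE) fg ce. Qed.

Lemma mul_pmx f g c e :
  pmx f c *m pmx g e = pmx (f \o g) (fun y => c (g y) * e y).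
Proof.
apply/matrixP=> i j; rewrite !(mxE, pmxE) (bigD1 (enum_rank (g (enum_val j)))) //=.
rewrite big1 => [|k ne_k]; rewrite !(mxE, pmxE); last first.
  rewrite [enum_val k == _](_ : _ = false) ?mulr0n ?mulr0 //.
  by apply: contraNF ne_k => /eqP <-; rewrite enum_valK.
by rewrite enum_rankK eqxx mulr1n mulrnAl addr0.
Qed.

Lemma tr_pmx f c : involutive f -> (pmx f c)^T = pmx f (c \o f).
Proof.
move=> fK; apply/matrixP=> i j; rewrite !(mxE, pmxE) /=.
rewrite eq_sym (can2_eq fK fK).
by case: eqP => [->|]; rewrite ?mulr0n // fK.
Qed.

Lemma opp_pmx f c : - pmx f c = pmx f (fun y => - c y).
Proof. by apply/matrixP=> i j; rewrite !(mxE, pmxE) mulNrn. Qed.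

Definition proj F : 'M[R]_#|T| := pmx id (fun y => (y \in F)%:R).

Lemma projE F : proj F = diag_mx (\row_i (enum_val i \in F)%:R).
Proof.
by apply/matrixP=> i j; rewrite !(mxE, pmxE) (inj_eq enum_val_inj); case: eqP => // ->.
Qed.

Lemma tr_proj F : (proj F)^T = proj F.
Proof. by rewrite tr_pmx. Qed.

Lemma mul_proj F G : proj F *m proj G = proj (F :&: G).
Proof. by rewrite mul_pmx; apply: eq_pmx => // y; rewrite inE -natrM mulnb. Qed.

Lemma proj_idem F : proj F *m proj F = proj F.
Proof. by rewrite mul_proj setIid. Qed.

Lemma projT : proj setT = 1%:M.
Proof. by apply/matrixP=> i j; rewrite !(mxE, pmxE) inE (inj_eq enum_val_inj). Qed.

Lemma proj_setU F (G : {set T}) : [disjoint F & G] -> proj (F :|: G) = proj F + proj G.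
Proof.
move=> dFG; apply/matrixP=> i j; rewrite !(mxE, pmxE) -mulrnDl -natrD inE.
congr (_%:R *+ _); have := disjointFr dFG; move/(_ (enum_val j)).
by case: (_ \in F) => // ->.
Qed.

Lemma det_proj_add F (a : R) :
  \det (proj F + a *: (1%:M - proj F)) = a ^+ (#|T| - #|F|).
Proof.
rewrite -projT !projE -linearB -linearZ -linearD det_diag.
under eq_bigr do rewrite !(mxE, pmxE) inE.
rewrite -(big_enum_val (fun y : T => (y \in F)%:R + a * (1 - (y \in F)%:R))) /=.
rewrite (bigID (mem F)) /= big1 => [|y ->]; last by rewrite subrr mulr0 addr0.
rewrite (eq_bigr (fun=> a)) => [|y /negbTE->]; last by rewrite subr0 mulr1 add0r.
by rewrite prodr_const mul1r -(cardC F) addKn.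
Qed.
End PartialPermutations.

(** * Anticommuting annihilation operators *)

(** A mark in [C] is carried along unchanged by all operators; it will be the
    square part of a monomial. *)
Definition marked_set (n : nat) (C : finType) : finType := ({set 'I_n} * C)%type.

Section Fermions.
Local Open Scope ring_scope.
Variables (R : realFieldType) (n : nat) (C : finType).
Local Notation T := (marked_set n C).
Implicit Types (i j l : 'I_n) (x y : T) (F : {set T}).

Definition toggle j x : T := ([set l | (l == j) (+) (l \in x.1)], x.2).

Lemma in_toggle l j x : (l \in (toggle j x).1) = (l == j) (+) (l \in x.1).
Proof. by rewrite inE. Qed.

Lemma toggleK j : involutive (toggle j).
Proof.
move=> [S c]; congr (_, _); apply/setP=> l.
by rewrite !inE addbA addbb.
Qed.

Lemma toggleC j l x : toggle j (toggle l x) = toggle l (toggle j x).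
Proof. by congr (_, _); apply/setP=> k; rewrite !inE addbCA. Qed.

(** The sign of the boundary operator of the exterior algebra. *)
Definition koszul j x : R := \prod_(l < n | (l < j)%N) (-1) ^+ (l \in x.1).

Lemma koszul_toggle j l x : koszul j (toggle l x) = (-1) ^+ (l < j)%N * koszul j x.
Proof.
rewrite /koszul; case: ltnP => lj; last first.
  rewrite mul1r; apply: eq_bigr => k kj; rewrite in_toggle.
  by case: eqP kj => // ->; rewrite ltnNge lj.
rewrite (bigD1 l) //= [in RHS](bigD1 l) //= in_toggle eqxx signr_addb -mulrA.
congr (_ * (_ * _)); apply: eq_bigr => k /andP[_ /negbTE kl].
by rewrite in_toggle kl.
Qed.

Definition annihilation j : 'M[R]_#|T| :=
  pmx (toggle j) (fun y => (j \in y.1)%:R * koszul j y).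
Local Notation b := annihilation.

Lemma tr_annihilation j :
  (b j)^T = pmx (toggle j) (fun y => (j \notin y.1)%:R * koszul j y).
Proof.
rewrite tr_pmx; last exact: toggleK.
by apply: eq_pmx => // y /=; rewrite in_toggle eqxx koszul_toggle ltnn mul1r.
Qed.

Lemma koszul_sqr j x : koszul j x * koszul j x = 1.
Proof.
by rewrite -big_split big1 //= => l _; rewrite -exprD addnn -mul2n exprM sqrrN !expr1n.
Qed.

(** Of two distinct elements exactly one precedes the other, hence toggling both
    in the two possible orders gives opposite signs. *)
Lemma koszulCN j l x : j != l ->
  koszul j (toggle l x) * koszul l x = - (koszul l (toggle j x) * koszul j x).
Proof.
rewrite -(inj_eq val_inj) /= neq_ltn !koszul_toggle => /orP[] lt_jl.
  by rewrite lt_jl ltnNge ltnW //= !mul1r mulrC expr1 mulN1r mulNr opprK.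
by rewrite lt_jl ltnNge ltnW //= !mul1r expr1 mulN1r mulNr mulrC.
Qed.

Lemma annihilationCN j l : b j *m b l = - (b l *m b j).
Proof.
rewrite /annihilation 2!mul_pmx opp_pmx; apply: eq_pmx => [x|x] /=; first exact: toggleC.
rewrite !in_toggle; have [->|jl] := eqVneq j l.
  by case: (l \in _) => /=; rewrite !(mul0r, mulr0) oppr0.
rewrite /= [LHS]mulrACA [in RHS]mulrACA koszulCN // mulrN.
by rewrite [(l \in _)%:R * _]mulrC.
Qed.

Lemma annihilation_trCN j l : j != l -> b j *m (b l)^T = - ((b l)^T *m b j).
Proof.
move=> jl; rewrite tr_annihilation !mul_pmx opp_pmx.
apply: eq_pmx => [x|x] /=; first exact: toggleC.
rewrite !in_toggle [l == j]eq_sym (negbTE jl) /= [LHS]mulrACA [in RHS]mulrACA koszulCN //.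
by rewrite mulrN [(l \notin _)%:R * _]mulrC.
Qed.

Lemma mul_annihilation_tr j : b j *m (b j)^T = proj R [set x : T | j \notin x.1].
Proof.
rewrite tr_annihilation mul_pmx; apply: eq_pmx => x /=; first exact: toggleK.
rewrite in_toggle eqxx koszul_toggle ltnn mul1r mulrACA koszul_sqr mulr1 inE.
by rewrite -natrM mulnb andbb.
Qed.

Lemma tr_annihilation_proj j F :
  (b j)^T *m proj R F *m b j = proj R [set x : T | (j \in x.1) && (toggle j x \in F)].
Proof.
rewrite tr_annihilation !mul_pmx; apply: eq_pmx => x /=; first exact: toggleK.
rewrite koszul_toggle ltnn mul1r !in_set eqxx.
case: (j \in x.1) => /=; last by rewrite !mul0r.
by rewrite !mul1r mulrAC koszul_sqr mul1r.
Qed.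

Lemma annihilation_proj0 j F : (forall x, x \in F -> j \notin x.1) ->
  b j *m proj R F = 0.
Proof.
move=> evF; rewrite mul_pmx; apply/matrixP=> p q; rewrite !(mxE, pmxE) /=.
case: (boolP (_ \in F)) => [/evF/negbTE->|_].
  by rewrite !mul0r mul0rn.
by rewrite mulr0 mul0rn.
Qed.
End Fermions.

(** * The algebra of near-cones *)

Section NearConeAlgebra.
Local Open Scope ring_scope.

Lemma conj_projector (R : realFieldType) m p (P : 'M[R]_m) (A : 'M[R]_(p, m)) :
  P^T = P -> P *m P = P -> A *m P *m A^T = A *m P *m (A *m P)^T.
Proof. by move=> PT PP; rewrite trmx_mul PT !mulmxA -(mulmxA A P P) PP. Qed.

(* [b] removes the first element, [D] is the boundary in the others, [E] and [P]
   are the projectors on the deletion and on the link; [PDE] says that [D] maps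
   the deletion into the link. *)
Variables (R : realFieldType) (m : nat) (b D E P : 'M[R]_m) (x : R).
Hypotheses (x0 : x != 0) (x1 : x != 1) (PT : P^T = P) (ET : E^T = E).
Hypotheses (PP : P *m P = P) (EE : E *m E = E).
Hypotheses (bE : b *m E = 0) (bP : b *m P = 0) (bbP : b *m b^T *m P = P).
Hypotheses (DD : D *m D = 0) (bD : b *m D = - (D *m b)).
Hypotheses (Db : D *m b^T = - (b^T *m D)) (PDE : P *m (D *m E) = D *m E).

(** On the deletion, [D = (1 - b^T D) D] since [D D = 0]; the members through the
    first element are the image of the link under [b^T], and
    [(b + D) b^T = 1 - b^T D] on the link. *)
Lemma near_cone_factor :
  (b + D) *m (E + b^T *m P *m b) *m (b + D)^T
    = (1%:M - b^T *m D) *m (D *m E *m D^T + P) *m (1%:M - b^T *m D)^T.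
Proof.
set U := 1%:M - b^T *m D.
have UE : (b + D) *m E = U *m (D *m E).
  by rewrite mulmxDl bE add0r mulmxBl mul1mx !mulmxA -(mulmxA b^T) DD mulmx0 mul0mx subr0.
have UP : (b + D) *m b^T *m P = U *m P.
  by rewrite !mulmxDl bbP Db mul1mx.
have e1 : (b + D) *m E *m (b + D)^T = U *m (D *m E *m D^T) *m U^T.
  rewrite (conj_projector (b + D)) // (conj_projector D) // UE.
  by rewrite [(U *m _)^T]trmx_mul !mulmxA.
have e2 : (b + D) *m (b^T *m P *m b) *m (b + D)^T = U *m P *m U^T.
  rewrite (conj_projector U) // -UP trmx_mul [((b + D) *m b^T)^T]trmx_mul trmxK PT.
  by rewrite !mulmxA -[_ *m P *m P]mulmxA PP.
by rewrite mulmxDr mulmxDl e1 e2 -mulmxDl -mulmxDr.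
Qed.

(** Shifting the spectrum of [Y] by 1 on the range of [P] only: the second factor
    corrects the excess multiplicity of the eigenvalue 1 on the kernel of [P]. *)
Lemma det_split_projector (Y : 'M[R]_m) :
  Y *m P = Y ->
  \det (x%:M - (P + Y))
    = \det ((x - 1)%:M - Y) * \det (P + (x / (x - 1)) *: (1%:M - P)).
Proof.
move=> YP; rewrite -det_mulmx; congr (\det _).
rewrite mulmxBl !mulmxDr !mul_scalar_mx scalerA mulrCA divff ?subr_eq0 // mulr1.
rewrite YP -scalemxAr mulmxBr mulmx1 YP subrr scaler0 addr0.
rewrite scalerBl scale1r scalerBr scalemx1.
by rewrite [x *: P - P + _]addrC (addrA _ (x *: P)) subrK opprD addrA.
Qed.
(** Cycling [1 - b^T D] in the factorization yields [P + A + C] with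
    [A = D E D^T], [C = P D^T D P] and [A C = 0]; the last factor on the right-hand
    side is a power of [x / (x - 1)]. *)
Lemma near_cone_det :
  \det (x%:M - (b + D) *m (E + b^T *m P *m b) *m (b + D)^T)
    * (x - 1) ^+ m
  = \det ((x - 1)%:M - D *m E *m D^T) * \det ((x - 1)%:M - D *m P *m D^T)
    * \det (P + (x / (x - 1)) *: (1%:M - P)).
Proof.
rewrite near_cone_factor; set U := 1%:M - _; set A := D *m E *m _.
pose C := P *m D^T *m (D *m P).
have EP : E *m D^T *m P = E *m D^T.
  by have := congr1 trmx PDE; rewrite !trmx_mul PT ET.
have AP : A *m P = A by rewrite /A -!(mulmxA D) EP.
have PA : P *m A = A by rewrite /A mulmxA PDE.
have CP : C *m P = C by rewrite /C -!mulmxA PP.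
have PC : P *m C = C by rewrite /C !mulmxA PP.
have AC : A *m C = 0.
  rewrite /C !mulmxA AP /A -!mulmxA [D^T *m (D^T *m _)]mulmxA -trmx_mul DD.
  by rewrite trmx0 mul0mx !mulmx0.
(* [D] commutes with [b b^T], which is the identity on sets without the first
   element. *)
have bbDP : b *m (b^T *m (D *m P)) = D *m P.
  have bTD : b^T *m D = - (D *m b^T) by rewrite Db opprK.
  rewrite (mulmxA b^T) bTD mulNmx mulmxN -(mulmxA D) (mulmxA b D) bD mulNmx.
  by rewrite opprK -(mulmxA D) (mulmxA b) bbP.
have Pb : P *m b^T = 0 by rewrite -PT -trmx_mul bP trmx0.
have UP : U *m P = P - b^T *m (D *m P) by rewrite mulmxBl mul1mx mulmxA.
have UU : P *m U^T *m (U *m P) = P + C.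
  rewrite -{1}PT -trmx_mul UP [(_ - _)^T]linearB /= !trmx_mul trmxK PT.
  rewrite mulmxBl !mulmxBr PP (mulmxA P b^T) Pb mul0mx subr0 -!(mulmxA _ b).
  by rewrite bP mulmx0 sub0r opprK bbDP.
have -> : U *m (A + P) *m U^T = (U *m P) *m ((A + P) *m (P *m U^T)).
  have S : P *m (A + P) *m P = A + P by rewrite mulmxDr PA PP mulmxDl AP PP.
  by rewrite -{1}S !mulmxA.
rewrite (det_scalar_sub_sqmulC (U *m P)) // -(mulmxA (A + P)) UU mulmxDl.
rewrite !mulmxDr AP AC PP PC addr0.
rewrite addrCA det_split_projector //; last by rewrite mulmxDl AP CP.
rewrite mulrAC [_ * (x - 1) ^+ m]mulrC det_scalar_sub_add //; congr (_ * _ * _).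
rewrite /C det_scalar_sub_sqmulC ?subr_eq0 // !mulmxA -(mulmxA _ P P) PP.
by [].
Qed.
End NearConeAlgebra.

(** * Spectra of shifted families *)

Section ShiftedFamilies.
Local Open Scope ring_scope.
Variables (R : realFieldType) (n : nat) (C : finType).
Local Notation T := (marked_set n C).
Local Notation b := (annihilation R C).
Local Notation proj := (proj R).
Implicit Types (j l : 'I_n) (F : {set T}).

(** Restricting the boundary to a tail of the variables, instead of renumbering
    them, keeps a single ambient space throughout the induction. *)
Definition tail_boundary (i : nat) : 'M[R]_#|T| := \sum_(j < n | (i <= j)%N) b j.
Local Notation D := tail_boundary.

Lemma tail_boundaryS (i : 'I_n) : D i = b i + D i.+1.
Proof.
rewrite /D (bigD1 i) //=; congr (_ + _); apply: eq_bigl => j.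
by rewrite ltn_neqAle andbC eq_sym.
Qed.

Lemma tail_boundary_end : D n = 0.
Proof. by rewrite /D big_pred0 // => j; rewrite leqNgt ltn_ord. Qed.

Lemma tail_boundary_sqr i : D i *m D i = 0.
Proof.
have DDN : D i *m D i = - (D i *m D i).
  have -> : D i *m D i
      = \sum_(j < n | (i <= j)%N) \sum_(l < n | (i <= l)%N) b j *m b l.
    by rewrite mulmx_suml; apply: eq_bigr => j _; rewrite mulmx_sumr.
  rewrite [LHS]exchange_big /= raddf_sum /=; apply: eq_bigr => j _.
  by rewrite raddf_sum /=; apply: eq_bigr => l _; exact: annihilationCN.
have: (2%:R : R) *: (D i *m D i) = 0.
  by rewrite scaler_nat mulr2n {2}DDN subrr.
by move/eqP; rewrite scaler_eq0 pnatr_eq0 /= => /eqP.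
Qed.

Lemma annihilation_tail_boundary j i : b j *m D i = - (D i *m b j).
Proof.
rewrite mulmx_sumr mulmx_suml raddf_sum /=.
by apply: eq_bigr => l _; exact: annihilationCN.
Qed.

Lemma tail_boundary_tr_annihilation j : D j.+1 *m (b j)^T = - ((b j)^T *m D j.+1).
Proof.
rewrite mulmx_sumr mulmx_suml raddf_sum /=.
apply: eq_bigr => l lt_jl; apply: annihilation_trCN.
by rewrite -(inj_eq val_inj) /= gtn_eqF.
Qed.

Definition shifted_from (i : nat) F := forall j l (x : T),
  (i <= j < l)%N -> j \notin x.1 -> l \in x.1 ->
  x \in F -> toggle j (toggle l x) \in F.

Definition deletion j F : {set T} := [set x in F | j \notin x.1].
Definition link j F : {set T} := [set x : T | (j \notin x.1) && (toggle j x \in F)].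

Lemma shifted_deletion j F : shifted_from j F -> shifted_from j.+1 (deletion j F).
Proof.
move=> shF k l x /andP[jk kl] kx lx; rewrite in_set => /andP[xF jx].
have kj : (j == k) = false by rewrite -(inj_eq val_inj) /= ltn_eqF.
have lj : (j == l) = false by rewrite -(inj_eq val_inj) /= ltn_eqF // (ltn_trans jk).
by rewrite in_set shF ?(ltnW jk) // !in_toggle kj lj.
Qed.

Lemma shifted_link j F : shifted_from j F -> shifted_from j.+1 (link j F).
Proof.
move=> shF k l x /andP[jk kl] kx lx; rewrite in_set => /andP[jx xF].
have kj : (j == k) = false by rewrite -(inj_eq val_inj) /= ltn_eqF.
have lj : (j == l) = false by rewrite -(inj_eq val_inj) /= ltn_eqF // (ltn_trans jk).
rewrite in_set !in_toggle kj lj jx toggleC (toggleC j l).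
by apply: shF; rewrite ?(ltnW jk) ?in_toggle // eq_sym ?kj ?lj.
Qed.

Lemma proj_deletion_link j F :
  proj F = proj (deletion j F) + (b j)^T *m proj (link j F) *m b j.
Proof.
rewrite tr_annihilation_proj -proj_setU.
  congr proj; apply/setP=> x; rewrite !inE toggleK.
  by rewrite eqxx; case: (_ \in F); case: (_ \in x.1).
rewrite disjoints_subset; apply/subsetP=> x; rewrite !inE => /andP[_ /negbTE->].
by [].
Qed.

(** Here shiftedness enters: when a later element of a member without [j] is
    removed, putting [j] in its place gives a member, so the result is in the
    link. *)
Lemma link_tail_boundary j F : shifted_from j F ->
  proj (link j F) *m (D j.+1 *m proj (deletion j F)) = D j.+1 *m proj (deletion j F).
Proof.
move=> shF; rewrite /D mulmx_suml mulmx_sumr; apply: eq_bigr => l jl.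
rewrite !mul_pmx; apply: eq_pmx => //= x.
rewrite [x \in deletion _ _]in_set [_ \in link _ _]in_set in_toggle.
case lx : (l \in x.1); last by rewrite !(mul0r, mulr0).
case: (boolP (x \in F)) => xF; last by rewrite !(mul0r, mulr0).
case: (boolP (j \in x.1)) => jx; first by rewrite !(mul0r, mulr0).
rewrite shF ?jl ?leqnn // addbF.
by rewrite -(inj_eq val_inj) /= ltn_eqF // !mul1r.
Qed.

Definition weight (x : R) (S : {set 'I_n}) (i : nat) : R :=
  \prod_(j < n | (j \in S) && (i <= j)%N)
     ((x - (j - i)%:R - 1) / (x - (j - i)%:R)).

(** Passing to the next first element lowers the relative indices by 1, which a
    shift of [x] by 1 compensates. *)
Lemma weightS (x : R) S (i : 'I_n) :
  weight x S i = (if i \in S then (x - 1) / x else 1) * weight (x - 1) S i.+1.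
Proof.
have tailE : weight (x - 1) S i.+1 =
    \prod_(j < n | (j \in S) && (i < j)%N) ((x - (j - i)%:R - 1) / (x - (j - i)%:R)).
  apply: eq_bigr => j /andP[_ ij]; rewrite -(subnSK ij) -natr1.
  by congr (_ / _); ring.
rewrite tailE /weight; case: ifP => iS; last first.
  rewrite mul1r; apply: eq_bigl => j; rewrite leq_eqVlt.
  case: (eqVneq (i : nat) j) => [/val_inj<-|]; by rewrite ?iS.
rewrite (bigD1 i) ?iS ?leqnn //= subnn subr0; congr (_ * _).
apply: eq_bigl => j; rewrite -andbA ltn_neqAle [in RHS]eq_sym (inj_eq val_inj).
by rewrite [(i <= j)%N && _]andbC.
Qed.

Lemma weight_toggle x (y : T) j : weight x (toggle j y).1 j.+1 = weight x y.1 j.+1.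
Proof.
apply: eq_bigl => l; rewrite in_toggle; case: eqP => // ->.
by rewrite ltnn !andbF.
Qed.

(** The members containing [j] correspond to the link by [toggle j]; each of them
    contributes one extra factor, of relative index 0. *)
Lemma prod_weight_split (x : R) F j :
  \prod_(y in F) weight x y.1 j
    = ((x - 1) / x) ^+ #|link j F|
      * (\prod_(y in deletion j F) weight (x - 1) y.1 j.+1
         * \prod_(y in link j F) weight (x - 1) y.1 j.+1).
Proof.
rewrite (bigID (fun y : T => j \notin y.1)) /= mulrCA; congr (_ * _).
  rewrite [RHS](eq_bigl _ _ (fun y => in_set _ y)) /=.
  by apply: eq_bigr => y /andP[_ /negbTE jy]; rewrite weightS jy mul1r.
rewrite -prodr_const -big_split /= (reindex_inj (inv_inj (toggleK j))) /=.
apply: eq_big => [y|y /andP[_ jy]].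
  by rewrite !inE eqxx negbK andbC.
by rewrite weightS negbK in jy *; rewrite jy weight_toggle.
Qed.

(** The Duval-Reiner theorem in multiplicative form. *)
Theorem det_shifted_laplacian (i : nat) F (x : R) :
  (i <= n)%N -> shifted_from i F -> x < 0 ->
  \det (x%:M - D i *m proj F *m (D i)^T)
    = x ^+ #|T| * \prod_(y in F) weight x y.1 i.
Proof.
move eq_d : (n - i)%N => d; elim: d => [|d IH] in i F x eq_d *.
  move=> le_in shF x0; have ->: i = n by apply/eqP; rewrite eqn_leq le_in -subn_eq0 eq_d.
  rewrite tail_boundary_end !mul0mx subr0 det_scalar big1 ?mulr1 // => y _.
  by rewrite /weight big_pred0 // => j; rewrite leqNgt ltn_ord andbF.
move=> _ shF x0; have lt_in : (i < n)%N by rewrite -subn_gt0 eq_d.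
pose j := Ordinal lt_in; have {1 2 3}-> : i = j by [].
have dS : (n - j.+1)%N = d by rewrite subnS eq_d.
have x1 : x - 1 < 0 by rewrite subr_lt0 (lt_trans x0) ?ltr01.
have evE y : y \in deletion j F -> j \notin y.1 by rewrite in_set => /andP[].
have evL y : y \in link j F -> j \notin y.1 by rewrite in_set => /andP[].
(* From here on the induction hypothesis is used at [x - 1]. *)
rewrite (proj_deletion_link j F) tail_boundaryS.
set E := proj (deletion j F); set P := proj (link j F).
have PT : P^T = P by exact: tr_proj.
have PP : P *m P = P by exact: proj_idem.
have bbP : b j *m (b j)^T *m P = P.
  rewrite mul_annihilation_tr mul_proj; congr proj; apply/setIidPr.
  by apply/subsetP=> y /evL; rewrite inE.
have PDE : P *m (D j.+1 *m E) = D j.+1 *m E by exact: link_tail_boundary.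
have x1n : (x - 1) ^+ #|T| != 0 by rewrite expf_neq0 // lt_eqF.
apply: (mulIf x1n); rewrite near_cone_det ?tr_proj ?proj_idem //; first last.
- exact: tail_boundary_tr_annihilation.
- exact: annihilation_tail_boundary.
- exact: tail_boundary_sqr.
- exact: annihilation_proj0.
- exact: annihilation_proj0.
- by rewrite lt_eqF // (lt_trans x0) ?ltr01.
- by rewrite lt_eqF.
rewrite det_proj_add !IH //; [|exact: shifted_link|exact: shifted_deletion].
rewrite prod_weight_split exprB ?max_card ?unitfE ?mulf_neq0 ?invr_eq0 ?lt_eqF //.
have rearrange (a u c v p q : R) : u != 0 -> c != 0 -> v != 0 ->
    u * p * (u * q) * (a / u / (c / v)) = a * (v / c * (p * q)) * u.
  by move=> u0 c0 v0; field; rewrite u0 c0 v0.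
by rewrite !expr_div_n rearrange // expf_neq0 // lt_eqF.
Qed.
End ShiftedFamilies.

(** * Multicomplexes as families of marked sets *)

Section Multicomplexes.
Local Open Scope ring_scope.
Variables (R : realType) (n : nat) (M : multicomplex n) (d : nat).
Implicit Types (m : 'X_{1..n}) (j l : 'I_n) (x : R).

Definition odd_support m : {set 'I_n} := [set j | odd (m j)].

(** Shiftedness as seen by the boundary operator, which only sees parities. *)
Definition odd_shifted := forall m j l, (j < l)%N ->
  ~~ odd (m j) -> odd (m l) -> m \in monomials M ->
  (m - U_(l) + U_(j))%MM \in monomials M.

Local Notation square_part := {ffun 'I_n -> 'I_d.+2}.
Local Notation T := (marked_set n square_part).
Local Notation D := (tail_boundary R n square_part 0).

(** The halves are bounded by [d.+1], so [code] is faithful up to that degree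
    ([code_inj]). *)
Definition code m : T := (odd_support m, [ffun j => inord (m j)./2]).

Lemma code_inj m m' : (mdeg m <= d.+1)%N -> (mdeg m' <= d.+1)%N ->
  code m = code m' -> m = m'.
Proof.
have le_half m1 j : (mdeg m1 <= d.+1)%N -> ((m1 j)./2 < d.+2)%N.
  move=> le_d; rewrite ltnS (leq_trans _ le_d) //.
  apply: (@leq_trans (m1 j)); first lia.
  by rewrite mdegE (bigD1 j) //= leq_addr.
move=> dm dm' [/setP eO /ffunP eH]; apply/mnmP => j.
have := eO j; have := congr1 (@nat_of_ord _) (eH j).
rewrite !inE !ffunE !inordK ?le_half //.
by move=> eh eo; rewrite -(odd_double_half (m j)) eo eh odd_double_half.
Qed.

Lemma code_subU m j : odd (m j) -> code (m - U_(j))%MM = toggle j (code m).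
Proof.
move=> mj; congr (_, _); [apply/setP=> l | apply/ffunP=> l].
  rewrite !inE mnmBE mnm1E eq_sym; case: (eqVneq l j) => [->|_]; last by rewrite subn0.
  by rewrite oddB ?odd_gt0 // mj.
rewrite !ffunE mnmBE mnm1E; congr inord.
by case: (eqVneq j l) mj => [<-|_] mj; last (by rewrite subn0); lia.
Qed.

Lemma code_addU m j : ~~ odd (m j) -> code (m + U_(j))%MM = toggle j (code m).
Proof.
move=> mj; rewrite -[m in RHS](addmK U_(j)%MM) code_subU ?toggleK //.
by rewrite mnmDE mnm1E eqxx addn1 /= mj.
Qed.

Lemma mdeg_subU m j : odd (m j) -> (mdeg (m - U_(j))).+1 = mdeg m.
Proof.
move=> mj; have U_le : (U_(j) <= m)%MM.
  by apply/mnm_lepP => k; rewrite mnm1E; case: eqP => // <-; rewrite odd_gt0.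
by rewrite -[in RHS](submK U_le) mdegD mdeg1 addn1.
Qed.

(** The inclusion of the monomials of degree [e] into the ambient space of marked
    sets; an isometry that compresses the ambient boundary operator to that of the
    multicomplex ([boundary_selection]). *)
Definition selection e : 'M[R]_(#|T|, #|{: graded M e}|) :=
  \matrix_(i, j) (enum_val i == code (val (enum_val j)))%:R.

Definition coded e : {set T} := [set code (val a) | a : graded M e].

Lemma mem_graded e (a : graded M e) : val a \in monomials M /\ mdeg (val a) = e.
Proof. by have := fsvalP a; rewrite /graded !in_fsetE /= => /andP[aM /eqP]. Qed.

Lemma mem_coded e m : m \in monomials M -> mdeg m = e -> code m \in coded e.
Proof.
move=> mM md; have m_gr : m \in graded M e.
  by rewrite /graded in_fset; apply/andP; split => //; apply/eqP.
by apply/imsetP; exists [` m_gr]%fset.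
Qed.

Lemma val_code_inj e : (e <= d.+1)%N -> injective (fun a : graded M e => code (val a)).
Proof.
by move=> le_e a a' /code_inj/val_inj-> //; rewrite (mem_graded _).2.
Qed.

Lemma tr_selection_selection e : (e <= d.+1)%N ->
  (selection e)^T *m selection e = 1%:M.
Proof.
move=> le_e; apply/matrixP=> i j; rewrite !mxE.
rewrite (bigD1 (enum_rank (code (val (enum_val i))))) //= !mxE enum_rankK eqxx.
rewrite big1 => [|k ne_k]; last first.
  rewrite !mxE; case: eqP => [ek|_]; last by rewrite mul0r.
  by rewrite -ek enum_valK eqxx in ne_k.
rewrite addr0 mul1r (inj_eq (val_code_inj le_e)) (inj_eq enum_val_inj).
by case: eqP.
Qed.

Lemma selection_tr_selection e : (e <= d.+1)%N ->
  selection e *m (selection e)^T = proj R (coded e).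
Proof.
move=> le_e; apply/matrixP=> i j; rewrite !mxE pmxE.
under eq_bigr do rewrite !mxE -natrM mulnb.
rewrite -(big_enum_val (fun a =>
  ((enum_val i == code (val a)) && (enum_val j == code (val a)))%:R)) /=.
case: imsetP => [[a _ ej]|nj]; last first.
  rewrite mul0rn big1 // => a _; case: eqP => // _; case: eqP => //= ej.
  by case: nj; exists a.
rewrite (bigD1 a) //= big1 => [|a' ne_a]; last first.
  rewrite ej (inj_eq (val_code_inj le_e)) [a == _]eq_sym (negbTE ne_a).
  by rewrite andbF.
by rewrite addr0 ej eqxx andbT; case: eqP.
Qed.

Lemma boundary_selection :
  boundary R M d = (selection d)^T *m D *m selection d.+1.
Proof.
apply/matrixP=> i j; rewrite !mxE; set a := val _; set b := val _.
have pick e (k : 'I_#|{: graded M e}|) (f : 'I_#|T| -> R) :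
    \sum_i f i * selection e i k = f (enum_rank (code (val (enum_val k)))).
  rewrite (bigD1 (enum_rank (code (val (enum_val k))))) //= !mxE enum_rankK eqxx mulr1.
  rewrite big1 ?addr0 // => l ne_l; rewrite !mxE.
  case: eqP => [el|_]; last by rewrite mulr0.
  by rewrite -el enum_valK eqxx in ne_l.
rewrite pick !mxE; under eq_bigr do rewrite [_^T _ _]mxE mulrC.
rewrite pick summxE /boundary_coef big_mkcond /=; apply: eq_bigr => l _.
rewrite pmxE !enum_rankK inE -/a -/b.
case al : (odd (a l)); last by rewrite /parity al mulr0 mul0r mul0rn if_same.
rewrite -code_subU //.
have [_ da] := mem_graded (enum_val j); have [_ db] := mem_graded (enum_val i).
have -> : (code b == code (a - U_(l))%MM) = ((a - U_(l))%MM == b).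
  apply/eqP/eqP => [|->] // /code_inj -> //; first by rewrite db.
  by rewrite (leq_trans _ (eq_leq da)) // !mdegE leq_sum // => k _; rewrite mnmBE leq_subr.
case: eqP => // _; rewrite /parity al mulr1 mul1r mulr1n /koszul.
by rewrite -prodrXr; apply: eq_bigr => k _; rewrite inE signr_odd.
Qed.

(** A multicomplex is closed under taking divisors, so the ambient boundary does
    not leave it. *)
Lemma coded_boundary :
  proj R (coded d) *m (D *m proj R (coded d.+1))
    = D *m proj R (coded d.+1).
Proof.
rewrite /tail_boundary mulmx_suml mulmx_sumr; apply: eq_bigr => l _.
rewrite !mul_pmx; apply: eq_pmx => //= y.
case: (boolP (l \in y.1)) => ly; last by rewrite !(mul0r, mulr0).
case: (boolP (y \in coded d.+1)) => [/imsetP[a _ ey]|_]; last by rewrite !mulr0.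
have [aM ad] := mem_graded a; rewrite ey /= inE in ly.
suff -> : toggle l y \in coded d by rewrite !mul1r.
rewrite ey -code_subU //; apply: mem_coded.
  by apply: (monomials_closed aM); apply/mnm_lepP => k; rewrite mnmBE leq_subr.
by apply: succn_inj; rewrite mdeg_subU.
Qed.

Lemma shifted_coded : odd_shifted -> shifted_from 0 (coded d.+1).
Proof.
move=> shM j l y lt_jl jy ly /imsetP[a _ ey]; have [aM ad] := mem_graded a.
rewrite {y}ey !inE in jy ly *.
have jl : (l == j) = false by rewrite -(inj_eq val_inj) /= gtn_eqF.
rewrite -code_subU // -code_addU; last by rewrite mnmBE mnm1E jl subn0.
apply: mem_coded; first exact: shM.
by rewrite mdegD mdeg1 addn1 mdeg_subU.
Qed.

(** The ambient Laplacian differs from that of the multicomplex by null rows and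
    columns, which only contribute powers of [x]. *)
Theorem det_multicomplex_laplacian x : odd_shifted -> x < 0 ->
  \det (x%:M - laplacian_up R M d)
    = x ^+ #|{: graded M d}|
      * \prod_(a : graded M d.+1) weight x (odd_support (val a)) 0.
Proof.
move=> shM x0; have xT : x ^+ #|T| != 0 by rewrite expf_neq0 // lt_eqF.
have BT : selection d *m boundary R M d = D *m selection d.+1.
  have SS : selection d.+1 = proj R (coded d.+1) *m selection d.+1.
    by rewrite -selection_tr_selection // -mulmxA tr_selection_selection // mulmx1.
  rewrite boundary_selection !mulmxA selection_tr_selection // SS !mulmxA.
  by rewrite -(mulmxA (proj _ _)) coded_boundary.
have KE : D *m proj R (coded d.+1) *m (D)^T
    = selection d *m (laplacian_up R M d *m (selection d)^T).
  rewrite -selection_tr_selection // !mulmxA -BT -!mulmxA -trmx_mul -BT trmx_mul.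
  by rewrite /laplacian_up !mulmxA.
have := det_shifted_laplacian (leq0n n) (shifted_coded shM) x0.
rewrite KE => detK.
have := det_scalar_sub_mulC (selection d)
  (laplacian_up R M d *m (selection d)^T) (ltr0_neq0 x0).
rewrite detK -mulmxA tr_selection_selection // mulmx1 mulrCA => /(mulfI xT) <-.
congr (_ * _); rewrite big_imset //= => a a' _ _.
exact: val_code_inj.
Qed.
End Multicomplexes.

(** * Conjugate partitions and integral spectra *)

Section Conjugates.
Implicit Types (s : seq nat) (t : nat -> nat).

(** Counting a downward closed predicate recovers it. Applied to the boxes of a
    partition by rows and by columns, this is what makes conjugation involutive. *)
Lemma count_initial (P : pred nat) n i :
  (forall i j, i <= j -> P j -> P i) ->
  (i < count P (iota 0 n)) = (i < n) && P i.
Proof.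
move=> P_down; elim: n => [|n IH] //.
have -> : iota 0 n.+1 = iota 0 n ++ [:: n] by rewrite -addn1 iotaD.
rewrite count_cat /= addn0.
case Pn : (P n).
  have -> : count P (iota 0 n) = n.
    apply/eqP; rewrite -[X in _ == X](size_iota 0 n) -all_count; apply/allP => k.
    by rewrite mem_iota add0n => /andP[_ /ltnW kn]; apply: P_down Pn.
  by rewrite addn1 ltnS; case: leqP => // le_in; rewrite (P_down i n).
rewrite addn0 IH ltnS [in RHS]leq_eqVlt.
by case: eqVneq => [->|//]; rewrite ltnn Pn.
Qed.

Lemma conjugate_iota s i :
  conjugate s i = count (fun j => i < nth 0 s j) (iota 0 (size s)).
Proof. by rewrite -[in LHS](mkseq_nth 0 s) /conjugate count_map. Qed.

Lemma ltn_conjugate s i j : sorted geq s -> (j < conjugate s i) = (i < nth 0 s j).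
Proof.
move=> s_sorted; rewrite conjugate_iota count_initial => [|k l le_kl il].
  by case: ltnP => //= le_sj; rewrite nth_default.
have ls : l < size s by case: (ltnP l (size s)) il => // le_sl; rewrite nth_default.
apply: leq_trans il _; move: le_kl; rewrite leq_eqVlt => /predU1P[->//|kl].
have geq_trans : transitive geq by move=> a b c ba ac; exact: leq_trans ac ba.
by apply: (sorted_ltn_nth geq_trans) => //; rewrite inE // (ltn_trans kl).
Qed.

(** The conjugate of [t], with exactly [r] parts: [r] will be the size of the
    Laplacian, so the zero eigenvalues are included. *)
Definition transpose n r t := mkseq (fun j => count (fun i => j < t i) (iota 0 n)) r.

Lemma sorted_transpose n r t : sorted geq (transpose n r t).
Proof.
apply: (@homo_sorted _ _ _ leq); last exact: iota_sorted.
by move=> j k le_jk; apply: sub_count => i /=; apply: leq_ltn_trans.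
Qed.

Lemma conjugate_transpose n r t i :
  (forall i j, i <= j -> t j <= t i) -> (forall i, t i <= r) ->
  (forall i, n <= i -> t i = 0) -> conjugate (transpose n r t) i = t i.
Proof.
move=> t_decr t_le t0; rewrite /conjugate count_map.
rewrite (eq_count (a2 := fun j => j < t i)) => [|j /=]; last first.
  rewrite count_initial => [|k l le_kl]; last by move=> /leq_trans; apply; exact: t_decr.
  by case: (ltnP i n) => // /t0->.
rewrite -(subnKC (t_le i)) iotaD count_cat.
rewrite (eq_in_count (a2 := predT)) => [|k]; last by rewrite mem_iota => /andP[_ ->].
rewrite count_predT size_iota (eq_in_count (a2 := pred0)) ?count_pred0 ?addn0 // => k.
by rewrite mem_iota add0n => /andP[le_tk _]; rewrite /= ltnNge le_tk.
Qed.
End Conjugates.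

Section IntegralSpectrum.
Local Open Scope ring_scope.
Variable (R : realType).
Implicit Types (x : R) (s : seq nat).

Lemma poly_eq_neg (p q : {poly R}) : (forall x, x < 0 -> p.[x] = q.[x]) -> p = q.
Proof.
move=> eq_pq; apply/eqP; rewrite -subr_eq0; apply/negPn/negP => pq0.
pose rs : seq R := [seq - i.+1%:R | i <- iota 0 (size (p - q))].
have := max_poly_roots pq0 (rs := rs); rewrite size_map size_iota ltnn.
suff: all (root (p - q)) rs /\ uniq rs by case=> -> -> /(_ isT isT).
split.
  apply/allP => _ /mapP[i _ ->]; rewrite /root hornerD hornerN eq_pq ?subrr //.
  by rewrite oppr_lt0 ltr0n.
rewrite map_inj_uniq ?iota_uniq // => i j /oppr_inj/eqP.
by rewrite eqr_nat => /eqP[].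
Qed.

Lemma horner_char_poly m (A : 'M[R]_m) x : (char_poly A).[x] = \det (x%:M - A).
Proof.
rewrite -[LHS]/(horner_eval x _) /char_poly -det_map_mx; congr (\det _).
apply/matrixP=> i j; rewrite !mxE /= /horner_eval !(hornerE, hornerMn) /=.
by [].
Qed.

Definition step_factor x (i : nat) : R := (x - i%:R - 1) / (x - i%:R).

Lemma prod_step_factor x m : x < 0 -> \prod_(i < m) step_factor x i = (x - m%:R) / x.
Proof.
move=> x0; elim: m => [|m IH]; first by rewrite big_ord0 subr0 divff ?lt_eqF.
rewrite big_ord_recr /= IH /step_factor -natr1 opprD addrA.
by field; rewrite subr_eq0 !lt_eqF // (lt_le_trans x0).
Qed.

(** Expanding each [(x - m) / x] by telescoping, the factor of index [i] occurs
    once for each part [m > i]. *)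
Lemma prod_conjugate x n s : x < 0 -> (forall i, (n <= i)%N -> conjugate s i = 0%N) ->
  \prod_(m <- s) ((x - m%:R) / x) = \prod_(i < n) step_factor x i ^+ conjugate s i.
Proof.
move=> x0; elim: s => [|m s IH] s_small.
  by rewrite big_nil big1 // => i _; rewrite expr0.
have m_le : (m <= n)%N.
  rewrite leqNgt; apply/negP => nm; have := s_small n (leqnn n).
  by rewrite /conjugate /= nm.
have s_small' i : (n <= i)%N -> conjugate s i = 0%N.
  move=> /s_small; rewrite /conjugate /=; case: count; rewrite ?addn0 // => k.
  by rewrite addnS.
rewrite big_cons IH // -prod_step_factor // (big_ord_widen n (step_factor x) m_le).
rewrite big_mkcond -big_split /=; apply: eq_bigr => i _.
by rewrite /conjugate /= exprD; case: ifP; rewrite ?expr0 ?expr1.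
Qed.

Variables (n : nat) (M : multicomplex n) (d : nat).

(** Indexed by all of [nat] rather than by ['I_n], to be compared with the
    conjugate of a partition. *)
Definition odd_degree (i : nat) : nat :=
  #|[pred a : graded M d.+1 | [exists j : 'I_n, (val j == i) && odd (val a j)]]|.

Lemma odd_degree_ord (j : 'I_n) :
  odd_degree j = #|[pred a : graded M d.+1 | odd (val a j)]|.
Proof.
apply: eq_card => a; rewrite !inE; apply/existsP/idP => [[l /andP[/eqP/val_inj->]]//|aj].
by exists j; rewrite eqxx.
Qed.

Lemma odd_degree_out i : (n <= i)%N -> odd_degree i = 0%N.
Proof.
move=> le_ni; apply: eq_card0 => a; rewrite inE; apply/existsP => -[j /andP[/eqP ji]].
by have := ltn_ord j; rewrite ji ltnNge le_ni.
Qed.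

Lemma prod_weight x :
  \prod_(a : graded M d.+1) weight x (odd_support (val a)) 0
    = \prod_(j < n) step_factor x j ^+ odd_degree j.
Proof.
under eq_bigr => a _.
  rewrite /weight (eq_bigl (fun j => odd (val a j))) => [|j]; last by rewrite inE andbT.
  rewrite big_mkcond /=; under eq_bigr do rewrite subn0 -/(step_factor x _).
  over.
rewrite exchange_big /=; apply: eq_bigr => j _.
by rewrite -big_mkcond prodr_const odd_degree_ord.
Qed.

Hypothesis shM : odd_shifted M.

Lemma odd_degree_coded (j : 'I_n) :
  odd_degree j = #|[set y in coded M d d.+1 | j \in y.1]|.
Proof.
rewrite odd_degree_ord.
rewrite -(card_in_imset (f := fun a : graded M d.+1 => code d (val a))); last first.
  by move=> a a' _ _; exact: val_code_inj.
apply: eq_card => y; rewrite inE; apply/imsetP/andP => [[a aj ->]|[/imsetP[a _ ->] aj]].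
  by split; [exact: imset_f | rewrite inE].
by exists a => //; rewrite !inE in aj *.
Qed.

(** Dividing by the variable of index [i] embeds the monomials counted by
    [odd_degree i] into those of degree [d]. *)
Lemma odd_degree_le i : (odd_degree i <= #|{: graded M d}|)%N.
Proof.
case: (ltnP i n) => [lt_in|/odd_degree_out->//].
rewrite -[i]/(val (Ordinal lt_in)) odd_degree_coded; set j := Ordinal lt_in.
have -> : #|{: graded M d}| = #|coded M d d|.
  by rewrite card_imset //; exact: val_code_inj.
rewrite -(card_imset _ (inv_inj (toggleK j))); apply: subset_leq_card.
apply/subsetP=> _ /imsetP[_ /setIdP[/imsetP[a _ ->] aj] ->].
rewrite inE in aj; have [aM ad] := mem_graded a; rewrite -code_subU //.
apply: mem_coded; last by apply: succn_inj; rewrite mdeg_subU.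
by apply: (monomials_closed aM); apply/mnm_lepP => k; rewrite mnmBE leq_subr.
Qed.

(** Where the exponent of index [j] is odd and that of index [i] is even,
    trade the former variable for the latter. *)
Lemma odd_degree_decr i j : (i <= j)%N -> (odd_degree j <= odd_degree i)%N.
Proof.
rewrite leq_eqVlt => /predU1P[->//|lt_ij].
case: (ltnP j n) => [lt_jn|/odd_degree_out->//].
have lt_in := ltn_trans lt_ij lt_jn.
rewrite -[j]/(val (Ordinal lt_jn)) -[i]/(val (Ordinal lt_in)) !odd_degree_coded.
set jn := Ordinal lt_jn; set im := Ordinal lt_in.
have ij : (im == jn) = false by rewrite -(inj_eq val_inj) /= ltn_eqF.
pose g (y : marked_set n {ffun 'I_n -> 'I_d.+2}) :=
  if im \in y.1 then y else toggle im (toggle jn y).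
have g_inj : {in [set y in coded M d d.+1 | jn \in y.1] &, injective g}.
  move=> y z /setIdP[_ yj] /setIdP[_ zj]; rewrite /g.
  case: ifP => yi; case: ifP => zi // eq_yz.
  - by rewrite eq_yz !in_toggle eq_sym ij eqxx zj in yj.
  - by rewrite -eq_yz !in_toggle eq_sym ij eqxx yj in zj.
  - exact: (inv_inj (toggleK jn)) (inv_inj (toggleK im) eq_yz).
rewrite -(card_in_imset g_inj); apply: subset_leq_card.
apply/subsetP=> _ /imsetP[y /setIdP[yF yj] ->]; rewrite /g.
case: ifP => [yi|/negbT yi]; rewrite in_set; first by rewrite yF.
by rewrite !in_toggle eqxx ij (negbTE yi) andbT (shifted_coded shM).
Qed.

(** Both sides of the characteristic polynomial identity agree at negative [x] by
    the determinant formula, hence they are equal. *)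
Theorem shifted_spectrum : exists s,
  [/\ is_spectrum (laplacian_up R M d) [seq m%:R | m <- s],
      sorted geq s & forall i, conjugate s i = odd_degree i].
Proof.
pose s := transpose n #|{: graded M d}| odd_degree.
have s_sorted : sorted geq s by exact: sorted_transpose.
have s_conj i : conjugate s i = odd_degree i.
  apply: conjugate_transpose; [exact: odd_degree_decr | exact: odd_degree_le |].
  exact: odd_degree_out.
exists s; split=> //; split.
  by rewrite sorted_map; apply: sub_sorted s_sorted => a b; rewrite /= ler_nat.
apply: poly_eq_neg => x x0; rewrite horner_char_poly det_multicomplex_laplacian //.
have s_out i : (n <= i)%N -> conjugate s i = 0%N.
  by move=> ?; rewrite s_conj odd_degree_out.
rewrite prod_weight.
rewrite (eq_bigr (fun j : 'I_n => step_factor x j ^+ conjugate s j)); last first.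
  by move=> j _; rewrite s_conj.
have size_s : size s = #|{: graded M d}| by rewrite size_mkseq.
clearbody s; rewrite -(prod_conjugate x0 s_out) -size_s big_map.
elim: (s) => [|m s' IH]; first by rewrite !big_nil mulr1 hornerC.
rewrite !big_cons hornerM hornerXsubC -IH exprS /=.
by field; rewrite lt_eqF.
Qed.
End IntegralSpectrum.

(** * The multicomplex of the integers up to N *)

Section Primes.

Lemma ltn_nth_prime : {mono nth_prime : i j / i < j}.
Proof.
apply: leqW_mono; apply: leq_mono => i j lt_ij.
apply: (homo_ltn (r := fun x y : nat => x < y)) lt_ij; first exact: ltn_trans.
by move=> k; have [] := next_primeP (nth_prime k).
Qed.

Lemma leq_next_prime m p : prime p -> m < p -> next_prime m <= p.
Proof.
move=> pr_p lt_mp; rewrite /next_prime; case: ex_minnP => q _ -> //.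
by rewrite lt_mp.
Qed.

Lemma ltn_index_nth_prime i : i < nth_prime i.
Proof.
elim: i => [|i IH]; first by case: (next_primeP 0).
by apply: leq_ltn_trans IH _; rewrite ltn_nth_prime.
Qed.

Lemma nth_prime_surj p : prime p -> exists i, nth_prime i = p.
Proof.
move=> pr_p; have ex_i : exists i, p <= nth_prime i.
  by exists p; exact: ltnW (ltn_index_nth_prime p).
case: (ex_minnP ex_i) => i le_pi min_i; exists i; apply/eqP; rewrite eqn_leq le_pi andbT.
apply: leq_next_prime => //; case: i min_i {le_pi} => [|i] min_i; first exact: prime_gt0.
by rewrite ltnNge; apply/negP => /min_i; rewrite ltnn.
Qed.

Lemma leq_nth_prime i j : i <= j -> nth_prime i <= nth_prime j.
Proof. by rewrite leq_eqVlt => /predU1P[->//|]; rewrite -ltn_nth_prime => /ltnW. Qed.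

Variable N : nat.

Lemma nth_prime_le i : (nth_prime i <= N) = (i < prime_count N).
Proof.
set P := fun i => nth_prime i <= N.
have P_down j l : j <= l -> P l -> P j by move=> /leq_nth_prime; exact: leq_trans.
have P_lt j : P j -> j < N by move=> /(leq_trans _); apply; exact: ltn_index_nth_prime.
suff -> : prime_count N = count P (iota 0 N).
  by rewrite count_initial // -/(P i); case Pi : (P i); rewrite ?andbF // P_lt.
rewrite /prime_count -!size_filter -[RHS](size_map nth_prime); apply: perm_size.
apply: uniq_perm; rewrite ?filter_uniq ?iota_uniq //.
  by rewrite (map_inj_uniq nth_prime_inj) filter_uniq ?iota_uniq.
move=> p; rewrite mem_filter mem_iota add1n ltnS; apply/and3P/mapP => [[pr_p _ le_pN]|].
  have [j ej] := nth_prime_surj pr_p; exists j => //.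
  have Pj : P j by rewrite /P ej.
  by rewrite mem_filter Pj mem_iota P_lt.
case=> j; rewrite mem_filter => /andP[Pj _] ->.
by rewrite prime_nth_prime prime_gt0 ?prime_nth_prime.
Qed.

Lemma perm_nth_prime :
  perm_eq [seq p <- iota 1 N | prime p] [seq nth_prime i | i <- iota 0 (prime_count N)].
Proof.
apply: uniq_perm; rewrite ?filter_uniq ?(map_inj_uniq nth_prime_inj) ?iota_uniq // => p.
rewrite mem_filter mem_iota add1n ltnS; apply/and3P/mapP => [[pr_p _ le_pN]|[j]].
  by have [j ej] := nth_prime_surj pr_p; exists j => //;
    rewrite mem_iota -nth_prime_le ej.
rewrite mem_iota -nth_prime_le => /andP[_ le_jN] ->.
by rewrite prime_nth_prime prime_gt0 ?prime_nth_prime.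
Qed.

Lemma logseq_out l i : 0 < l <= N -> prime_count N <= i -> logseq l i = 0.
Proof.
case/andP=> l_gt0 le_lN; rewrite leqNgt -nth_prime_le -ltnNge => lt_Ni.
apply/eqP; rewrite -leqn0 leqNgt logn_gt0 mem_primes prime_nth_prime l_gt0 /=.
by apply/negP => /(dvdn_leq l_gt0); rewrite leqNgt (leq_ltn_trans le_lN).
Qed.

Lemma integer_monomial_inj l l' : 0 < l <= N -> 0 < l' <= N ->
  integer_monomial N l = integer_monomial N l' -> l = l'.
Proof.
move=> hl hl' /mnmP eq_ll'; have [[l0 _] [l0' _]] := (andP hl, andP hl').
apply: eqn_from_log => // p; case: (boolP (prime p)) => [pr_p|npr]; last first.
  by rewrite [LHS]lognE [RHS]lognE (negbTE npr).
have [i <-] := nth_prime_surj pr_p; rewrite -/(logseq l i) -/(logseq l' i).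
case: (ltnP i (prime_count N)) => [lt_i|le_i]; last by rewrite !logseq_out.
by have := eq_ll' (Ordinal lt_i); rewrite !mnmE.
Qed.

Lemma mdeg_integer_monomial l : 0 < l <= N -> mdeg (integer_monomial N l) = Omega l.
Proof.
move=> /andP[l_gt0 le_lN]; rewrite mdegE; under eq_bigr do rewrite mnmE /logseq.
rewrite -(big_mkord predT (fun i => logn (nth_prime i) l)) /index_iota subn0.
rewrite -(big_map nth_prime predT (fun p => logn p l)) -(perm_big _ perm_nth_prime) /=.
rewrite (bigID (mem (primes l))) /=.
rewrite [X in _ + X]big1_seq ?addn0 => [|p /andP[]]; last first.
  by rewrite -logn_gt0 lt0n negbK => /eqP.
rewrite -big_filter /Omega; apply: perm_big; apply: uniq_perm.
- by rewrite !filter_uniq ?iota_uniq.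
- exact: primes_uniq.
move=> p; rewrite !mem_filter mem_iota add1n ltnS; case: (boolP (p \in primes l)) => //=.
rewrite mem_primes => /and3P[pr_p _ /(dvdn_leq l_gt0) le_pl].
by rewrite pr_p prime_gt0 // (leq_trans le_pl).
Qed.

(** Replacing a prime factor by a smaller prime keeps the integer below [N]. *)
Lemma odd_shifted_integers : odd_shifted (integer_multicomplex N).
Proof.
move=> m j l lt_jl _ ml /imfsetP[q /=].
rewrite mem_iota add1n ltnS => /andP[q_gt0 le_qN] em.
have pr := prime_nth_prime.
have dvd_q : nth_prime l %| q.
  have: 0 < logn (nth_prime l) q by have := odd_gt0 ml; rewrite em mnmE.
  by rewrite logn_gt0 mem_primes => /and3P[].
have q1_gt0 : 0 < q %/ nth_prime l by rewrite divn_gt0 ?prime_gt0 // dvdn_leq.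
apply/imfsetP; exists (q %/ nth_prime l * nth_prime j) => /=.
  rewrite mem_iota add1n ltnS muln_gt0 q1_gt0 prime_gt0 //=.
  rewrite (leq_trans _ le_qN) // -[leqRHS](divnK dvd_q) leq_mul2l ltnW ?orbT //.
  by rewrite ltn_nth_prime.
apply/mnmP => i; rewrite mnmDE mnmBE !mnm1E em !mnmE /logseq.
rewrite lognM ?(prime_gt0 (pr j)) // logn_div //.
rewrite (logn_prime _ (pr l)) (logn_prime _ (pr j)) !(inj_eq nth_prime_inj).
by rewrite ![val i == _]eq_sym.
Qed.

Lemma odd_degree_integers d i :
  odd_degree (integer_multicomplex N) d i
    = \sum_(1 <= l < N.+1 | Omega l == d.+1) parity (logseq l i).
Proof.
case: (ltnP i (prime_count N)) => [lt_i|le_i]; last first.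
  rewrite odd_degree_out // big_nat_cond big1 // => l /andP[hl _].
  by rewrite (logseq_out _ le_i).
rewrite -[i]/(val (Ordinal lt_i)) odd_degree_ord; set j := Ordinal lt_i.
rewrite -sum1_card big_mkcond /=.
rewrite (eq_bigr (fun a : graded _ _ => parity (val a j))) => [|a _]; last first.
  by rewrite inE /parity; case: odd.
rewrite -(big_seq_fsetE addn (graded _ _) predT (fun m : 'X_{1.._} => parity (m j))) /=.
have pm : perm_eq (graded (integer_multicomplex N) d.+1)
    [seq integer_monomial N l | l <- iota 1 N & Omega l == d.+1].
  apply: uniq_perm; first exact: fset_uniq.
    rewrite map_inj_in_uniq ?filter_uniq ?iota_uniq // => l l'.
    rewrite !mem_filter !mem_iota !add1n !ltnS => /andP[_ hl] /andP[_ hl'].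
    exact: integer_monomial_inj.
  move=> m; rewrite in_fset; apply/andP/mapP => [[/imfsetP[l /= hl ->] dl]|[l]].
    exists l => //; rewrite mem_filter hl andbT -mdeg_integer_monomial //.
    by rewrite mem_iota add1n ltnS in hl.
  rewrite mem_filter => /andP[Ol hl] ->; split; first by apply/imfsetP; exists l.
  by rewrite mdeg_integer_monomial //; rewrite mem_iota add1n ltnS in hl.
rewrite (perm_big _ pm) big_map big_filter /index_iota subn1.
by apply: eq_bigr => l _; rewrite mnmE.
Qed.
End Primes.

Section SquarefreePart.

Lemma logn_prod_primes (s : seq nat) (e : nat -> nat) q : all prime s -> uniq s ->
  logn q (\prod_(p <- s) p ^ e p) = (q \in s) * e q.
Proof.
move=> pr_s uniq_s.
have gt0 r : all prime r -> 0 < \prod_(p <- r) p ^ e p.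
  move=> /allP pr_r; rewrite big_seq; apply: prodn_cond_gt0 => p /pr_r pr_p.
  by rewrite expn_gt0 prime_gt0.
elim: s pr_s uniq_s => [|p s IH] /=; first by rewrite big_nil logn1.
case/andP=> pr_p pr_s /andP[p_s uniq_s].
rewrite big_cons lognM ?gt0 ?expn_gt0 ?prime_gt0 // IH // lognX logn_prime // in_cons.
by case: eqVneq => [->|_]; rewrite ?(negbTE p_s) ?muln1 ?muln0 ?addn0 ?mul1n.
Qed.

Lemma logseq_sfp l i : logseq (sfp l) i = parity (logseq l i).
Proof.
rewrite /logseq /sfp.
rewrite (logn_prod_primes (fun p => parity (logn p l))) ?primes_uniq //; last first.
  by apply/allP => p; rewrite mem_primes => /and3P[].
rewrite -logn_gt0; case: posnP => [->|_] //; exact: mul1n.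
Qed.

Lemma sfp_gt0 l : 0 < sfp l.
Proof.
rewrite /sfp big_seq; apply: prodn_cond_gt0 => p.
by rewrite mem_primes expn_gt0 => /and3P[/prime_gt0->].
Qed.

Lemma dvdn_sfp l i : (nth_prime i %| sfp l) = odd (logseq l i).
Proof.
have -> : (nth_prime i %| sfp l) = (0 < logseq (sfp l) i).
  by rewrite logn_gt0 mem_primes prime_nth_prime sfp_gt0.
by rewrite logseq_sfp /parity; case: odd.
Qed.

(** The bounds [1 < n] and [0 < n] agree here, since [Omega 1 = 0 < k]. *)
Lemma card_odd_exponent N k i : 0 < k ->
  #|[pred n : 'I_N.+1 | [&& 1 < n, Omega n == k & nth_prime i %| sfp n]]|
    = \sum_(1 <= l < N.+1 | Omega l == k) parity (logseq l i).
Proof.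
move=> k_gt0; pose t l := [&& 1 < l, Omega l == k & nth_prime i %| sfp l].
rewrite -sum1_card big_mkcond /=.
rewrite (eq_bigr (fun l : 'I_N.+1 => (t l : nat))) => [|l _]; last first.
  by rewrite inE -/(t l); case: t.
rewrite -(big_mkord predT (fun l => (t l : nat))) /= big_ltn // /t /= add0n.
rewrite [RHS]big_mkcond; apply: eq_big_nat => l /andP[l_gt0 _].
rewrite dvdn_sfp /parity; case: eqP => [Ol|]; last by rewrite andbF.
suff -> : 1 < l by [].
rewrite ltn_neqAle l_gt0 andbT; apply/eqP => l1.
by move: k_gt0; rewrite -Ol -l1 /Omega big_nil.
Qed.
End SquarefreePart.

Theorem corollary14 (R : realType) (N k : nat) (hN : 1 <= N) (hk : 1 <= k) :
  exists s : seq nat,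
    is_spectrum (laplacian_up R (integer_multicomplex N) k.-1)
                [seq x%:R%R | x <- s] /\
    (forall i : nat,
       conjugate s i = \sum_(1 <= l < N.+1 | Omega l == k) parity (logseq l i)) /\
    (forall i : nat,
       \sum_(1 <= l < N.+1 | Omega l == k) parity (logseq l i) =
       \sum_(1 <= l < N.+1 | Omega l == k) logseq (sfp l) i) /\
    (forall i : nat,
       conjugate s i =
       #|[pred n : 'I_N.+1 | [&& 1 < n, Omega n == k & nth_prime i %| sfp n]]|) /\
    (forall j : nat,
       ([set i : nat | (j < conjugate s i)%N]%classic #= `I_(nth 0 s j))%card) /\
    (forall j : nat,
       ([set i : nat |
           (j < #|[pred n : 'I_N.+1 |
                   [&& 1 < n, Omega n == k & nth_prime i %| sfp n]]|)%N]%classic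
        #= `I_(nth 0 s j))%card).
Proof.
case: k hk => // d _.
have [s [s_spec s_sorted s_conj]] := shifted_spectrum R d (@odd_shifted_integers N).
have s_sum i : conjugate s i
    = \sum_(1 <= l < N.+1 | Omega l == d.+1) parity (logseq l i).
  by rewrite s_conj odd_degree_integers.
have s_card i : conjugate s i
    = #|[pred n : 'I_N.+1 | [&& 1 < n, Omega n == d.+1 & nth_prime i %| sfp n]]|.
  by rewrite s_sum card_odd_exponent.
have s_part j : ([set i : nat | (j < conjugate s i)%N]%classic #= `I_(nth 0 s j))%card.
  suff -> : [set i : nat | (j < conjugate s i)%N]%classic = `I_(nth 0 s j)%classic by [].
  by apply/seteqP; split=> i /=; rewrite ltn_conjugate.
exists s; split=> //; split=> //; split; last split=> //; last split=> // j.
  by move=> i; apply: eq_bigr => l _; rewrite logseq_sfp.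
suff <- : [set i : nat | (j < conjugate s i)%N]%classic = [set i : nat |
    (j < #|[pred n : 'I_N.+1 | [&& 1 < n, Omega n == d.+1 & nth_prime i %| sfp n]]|)%N]%classic.
  exact: s_part.
by apply/seteqP; split=> i /=; rewrite s_card.
Qed.
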